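(* Let $w_n = 2n+1$ for $n \ge 0$, and let $M$ be the weighted mean matrix associated with the weight sequence $\{w_n\}_{n\ge 0}$, i.e. the lower triangular infinite matrix $M = [m_{ij}]_{i,j \ge 0}$ with $m_{ij} = w_j / W_i$ for $j \le i$ and $m_{ij} = 0$ for $j > i$, where $W_i = \sum_{j=0}^{i} w_j$. Then $M$ is a hyponormal operator on $\ell^2$.
   Context: Here $\ell^2$ is the Hilbert space of square-summable sequences indexed by $n = 0, 1, 2, \dots$, and an infinite matrix acts on $\ell^2$ with respect to the standard orthonormal basis by $(Mf)_i = \sum_j m_{ij} f_j$. For a Hilbert space $H$, $\mathcal{B}(H)$ denotes the set of all bounded linear operators on $H$. An operator $A \in \mathcal{B}(H)$ is hyponormal if $\langle (A^*A - AA^* ) f, f\rangle \ge 0$ for all $f \in H$. Thus calling $M$ a hyponormal operator on $\ell^2$ includes that $M$ defines a bounded operator on $\ell^2$. *)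

(* Defs.v *)
From Stdlib Require Import Reals Lra Arith.
From Stdlib Require Import FunctionalExtensionality ProofIrrelevance.
From Coquelicot Require Import Coquelicot.
Open Scope R_scope.

(** [l2] is made a [NormedModule] over the complex field, so that Coquelicot's
    [is_linear] on [l2 -> l2] says exactly "bounded linear operator". *)

Record l2 : Type := mk_l2 {
  l2_seq :> nat -> C;
  l2_summable : ex_series (fun n => Cmod (l2_seq n) ^ 2)
}.

Lemma l2_eq (f g : l2) : (forall n, f n = g n) -> f = g.
Proof.
destruct f as [f Hf], g as [g Hg]; simpl; intros E.
apply functional_extensionality in E; subst g.
now rewrite (proof_irrelevance _ Hf Hg).
Qed.

Lemma Cmod_plus_sqr (x y : C) (t : R) : 0 < t ->
  Cmod (x + y) ^ 2 <= (1 + t) * Cmod x ^ 2 + (1 + / t) * Cmod y ^ 2.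
Proof.
intros Ht.
apply Rle_trans with ((Cmod x + Cmod y) ^ 2).
{ apply pow_incr; split; [apply Cmod_ge_0 | apply Cmod_triangle]. }
set (a := Cmod x); set (b := Cmod y).
cut (0 <= / t * (t * a - b) ^ 2).
{ intros H.
  replace (/ t * (t * a - b) ^ 2)
    with (t * a ^ 2 - 2 * a * b + / t * b ^ 2) in H by (field; lra).
  nra. }
apply Rmult_le_pos; [left; now apply Rinv_0_lt_compat | apply pow2_ge_0].
Qed.

Lemma l2_zero_summable : ex_series (fun _ : nat => Cmod 0 ^ 2).
Proof.
exists 0; unfold is_series.
apply (filterlim_ext (fun _ => 0)); [| apply filterlim_const].
intros n; rewrite sum_n_const, Cmod_0; simpl; ring.
Qed.

Lemma l2_plus_summable (f g : l2) :
  ex_series (fun n => Cmod (f n + g n) ^ 2).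
Proof.
apply (ex_series_le (K := R_AbsRing) (V := R_CompleteNormedModule) _
  (fun n => (1 + 1) * Cmod (f n) ^ 2 + (1 + / 1) * Cmod (g n) ^ 2)).
{ intros n; change norm with Rabs.
  rewrite Rabs_pos_eq by apply pow2_ge_0.
  apply Cmod_plus_sqr; lra. }
apply (ex_series_plus (fun n => (1 + 1) * Cmod (f n) ^ 2)
                      (fun n => (1 + / 1) * Cmod (g n) ^ 2)).
- exact (ex_series_scal_l (1 + 1) _ (l2_summable f)).
- exact (ex_series_scal_l (1 + / 1) _ (l2_summable g)).
Qed.

Lemma l2_scal_summable (c : C) (f : l2) :
  ex_series (fun n => Cmod (c * f n) ^ 2).
Proof.
apply (ex_series_ext (fun n => Cmod c ^ 2 * Cmod (f n) ^ 2)).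
{ intros n; rewrite Cmod_mult; symmetry; apply Rpow_mult_distr. }
exact (ex_series_scal_l (Cmod c ^ 2) _ (l2_summable f)).
Qed.

Lemma l2_opp_summable (f : l2) : ex_series (fun n => Cmod (- f n) ^ 2).
Proof.
apply (ex_series_ext (fun n => Cmod (f n) ^ 2)).
{ intros n; now rewrite Cmod_opp. }
apply l2_summable.
Qed.

Definition l2_zero : l2 := mk_l2 (fun _ => RtoC 0) l2_zero_summable.
Definition l2_plus (f g : l2) : l2 :=
  mk_l2 (fun n => Cplus (f n) (g n)) (l2_plus_summable f g).
Definition l2_opp (f : l2) : l2 :=
  mk_l2 (fun n => Copp (f n)) (l2_opp_summable f).
Definition l2_scal (c : C) (f : l2) : l2 :=
  mk_l2 (fun n => Cmult c (f n)) (l2_scal_summable c f).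

Definition l2_norm (f : l2) : R := sqrt (Series (fun n => Cmod (f n) ^ 2)).

Definition l2_AbelianMonoid_mixin : AbelianMonoid.mixin_of l2.
Proof.
apply (AbelianMonoid.Mixin l2 l2_plus l2_zero).
- intros x y; apply l2_eq; intros n; apply Cplus_comm.
- intros x y z; apply l2_eq; intros n; apply Cplus_assoc.
- intros x; apply l2_eq; intros n; apply Cplus_0_r.
Defined.

Canonical l2_AbelianMonoid := AbelianMonoid.Pack l2 l2_AbelianMonoid_mixin l2.

Definition l2_AbelianGroup_mixin : AbelianGroup.mixin_of l2_AbelianMonoid.
Proof.
apply (AbelianGroup.Mixin l2_AbelianMonoid l2_opp).
intros x; apply l2_eq; intros n; apply Cplus_opp_r.
Defined.

Canonical l2_AbelianGroup := AbelianGroup.Pack l2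
  (AbelianGroup.Class l2 l2_AbelianMonoid_mixin l2_AbelianGroup_mixin) l2.

Definition l2_ModuleSpace_mixin : ModuleSpace.mixin_of C_Ring l2_AbelianGroup.
Proof.
apply (ModuleSpace.Mixin C_Ring l2_AbelianGroup l2_scal).
- intros x y u; apply l2_eq; intros n; apply Cmult_assoc.
- intros u; apply l2_eq; intros n; apply Cmult_1_l.
- intros x u v; apply l2_eq; intros n; apply Cmult_plus_distr_l.
- intros x y u; apply l2_eq; intros n; apply Cmult_plus_distr_r.
Defined.

Canonical l2_ModuleSpace := ModuleSpace.Pack C_Ring l2
  (ModuleSpace.Class C_Ring l2
     (AbelianGroup.class l2_AbelianGroup) l2_ModuleSpace_mixin) l2.

Lemma l2_sqr_sum_ge_0 (f : l2) : 0 <= Series (fun n => Cmod (f n) ^ 2).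
Proof.
replace 0 with (Series (fun n => 0 * Cmod (f n) ^ 2))
  by (rewrite Series_scal_l; ring).
apply Series_le; [| apply l2_summable].
intros n; assert (H := pow2_ge_0 (Cmod (f n))); lra.
Qed.

Lemma l2_norm_ge_0 (f : l2) : 0 <= l2_norm f.
Proof. apply sqrt_pos. Qed.

Lemma l2_norm_sqr (f : l2) : l2_norm f ^ 2 = Series (fun n => Cmod (f n) ^ 2).
Proof. apply pow2_sqrt, l2_sqr_sum_ge_0. Qed.

Lemma Cmod_le_l2_norm (f : l2) (n : nat) : Cmod (f n) <= l2_norm f.
Proof.
apply Rsqr_incr_0_var; [| apply l2_norm_ge_0].
rewrite !Rsqr_pow2, l2_norm_sqr.
assert (Hpos : forall k, 0 <= Cmod (f k) ^ 2) by (intros k; apply pow2_ge_0).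
apply Rle_trans with (sum_n (fun k => Cmod (f k) ^ 2) n).
- destruct n as [|n]; [rewrite sum_O; lra |].
  rewrite sum_Sn; change plus with Rplus.
  assert (0 <= sum_n (fun k => Cmod (f k) ^ 2) n); [| lra].
  clear -Hpos; induction n as [|n IH]; [now rewrite sum_O |].
  rewrite sum_Sn; change plus with Rplus; specialize (Hpos (S n)); lra.
- apply (is_lim_seq_incr_compare (sum_n (fun k => Cmod (f k) ^ 2))).
  + apply Series_correct, l2_summable.
  + intros k; rewrite sum_Sn; change plus with Rplus.
    specialize (Hpos (S k)); lra.
Qed.

Lemma l2_norm_eq_0 (f : l2) : l2_norm f = 0 -> f = l2_zero.
Proof.
intros H; apply l2_eq; intros n; apply Cmod_eq_0.
assert (H1 := Cmod_le_l2_norm f n); assert (H2 := Cmod_ge_0 (f n)).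
lra.
Qed.

Lemma l2_norm_triangle (f g : l2) :
  l2_norm (l2_plus f g) <= l2_norm f + l2_norm g.
Proof.
assert (Hf := l2_norm_ge_0 f); assert (Hg := l2_norm_ge_0 g).
destruct Hf as [Hf | Hf]; [destruct Hg as [Hg | Hg] |].
- apply Rsqr_incr_0_var; [| lra].
  rewrite !Rsqr_pow2, l2_norm_sqr.
  set (t := l2_norm g / l2_norm f).
  assert (Ht : 0 < t) by now apply Rdiv_lt_0_compat.
  assert (Sf : ex_series (fun n => (1 + t) * Cmod (f n) ^ 2))
    by exact (ex_series_scal_l (1 + t) _ (l2_summable f)).
  assert (Sg : ex_series (fun n => (1 + / t) * Cmod (g n) ^ 2))
    by exact (ex_series_scal_l (1 + / t) _ (l2_summable g)).
  apply Rle_trans with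
    (Series (fun n => (1 + t) * Cmod (f n) ^ 2 + (1 + / t) * Cmod (g n) ^ 2)).
  + apply Series_le.
    * intros n; split; [apply pow2_ge_0 | now apply Cmod_plus_sqr].
    * exact (ex_series_plus _ _ Sf Sg).
  + rewrite (Series_plus _ _ Sf Sg), !Series_scal_l, <- !l2_norm_sqr.
    right; unfold t; field; lra.
- rewrite (l2_norm_eq_0 g (eq_sym Hg)).
  replace (l2_plus f l2_zero) with f
    by (apply l2_eq; intros n; symmetry; apply Cplus_0_r).
  assert (H := l2_norm_ge_0 l2_zero); lra.
- rewrite (l2_norm_eq_0 f (eq_sym Hf)).
  replace (l2_plus l2_zero g) with g
    by (apply l2_eq; intros n; symmetry; apply Cplus_0_l).
  assert (H := l2_norm_ge_0 l2_zero); lra.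
Qed.

Lemma l2_norm_scal (c : C) (f : l2) :
  l2_norm (l2_scal c f) = Cmod c * l2_norm f.
Proof.
rewrite <- (sqrt_pow2 (Cmod c)) by apply Cmod_ge_0.
unfold l2_norm; rewrite <- sqrt_mult_alt by apply pow2_ge_0.
rewrite <- Series_scal_l; f_equal; apply Series_ext; intros n; simpl.
rewrite Cmod_mult; ring.
Qed.

Definition l2_ball (x : l2) (e : R) (y : l2) : Prop := l2_norm (minus y x) < e.

Definition l2_UniformSpace_mixin : UniformSpace.mixin_of l2.
Proof.
apply (UniformSpace.Mixin l2 l2_zero l2_ball).
- intros x e; unfold l2_ball; rewrite minus_eq_zero.
  change (l2_norm l2_zero < e).
  replace (l2_norm l2_zero) with 0; [apply cond_pos |].
  replace l2_zero with (l2_scal 0 l2_zero)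
    by (apply l2_eq; intros n; apply Cmult_0_l).
  rewrite l2_norm_scal, Cmod_0; ring.
- intros x y e; unfold l2_ball; intros H.
  rewrite <- opp_minus.
  replace (opp (minus y x)) with (l2_scal (- (1)) (minus y x)).
  + now rewrite l2_norm_scal, Cmod_opp, Cmod_1, Rmult_1_l.
  + apply l2_eq; intros n; simpl; ring.
- intros x y z e1 e2; unfold l2_ball; intros H1 H2.
  rewrite (minus_trans y z x).
  apply Rle_lt_trans with (1 := l2_norm_triangle _ _); lra.
Defined.

Canonical l2_UniformSpace := UniformSpace.Pack l2 l2_UniformSpace_mixin l2.

Canonical l2_NormedModuleAux := NormedModuleAux.Pack C_AbsRing l2
  (NormedModuleAux.Class C_AbsRing l2
     (ModuleSpace.class C_Ring l2_ModuleSpace) l2_UniformSpace_mixin) l2.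

Definition l2_NormedModule_mixin :
  NormedModule.mixin_of C_AbsRing l2_NormedModuleAux.
Proof.
apply (NormedModule.Mixin C_AbsRing l2_NormedModuleAux l2_norm 1).
- exact l2_norm_triangle.
- intros c x; right; exact (l2_norm_scal c x).
- intros x y e H; exact H.
- intros x y e H; rewrite Rmult_1_l; exact H.
- exact l2_norm_eq_0.
Defined.

Canonical l2_NormedModule := NormedModule.Pack C_AbsRing l2
  (NormedModule.Class C_AbsRing l2
     (NormedModuleAux.class C_AbsRing l2_NormedModuleAux)
     l2_NormedModule_mixin) l2.

(** Coquelicot's [Series] is real-valued, hence the two components;
    [is_series_inner] shows that this is the sum of the complex series. *)
Definition inner (f g : l2) : C :=
  (Series (fun n => Re (f n * Cconj (g n))),
   Series (fun n => Im (f n * Cconj (g n)))).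

Lemma is_series_C (a : nat -> C) (l : C) :
  is_series a l ->
  is_series (fun n => Re (a n)) (Re l) /\ is_series (fun n => Im (a n)) (Im l).
Proof.
intros H; unfold is_series in *.
assert (E : forall n, sum_n a n =
  (sum_n (fun n => Re (a n)) n, sum_n (fun n => Im (a n)) n)).
{ induction n as [|n IH].
  - rewrite !sum_O; unfold Re, Im; now rewrite <- surjective_pairing.
  - now rewrite !sum_Sn, IH. }
split.
- apply (filterlim_ext (fun n => Re (sum_n a n))); [now intros n; rewrite E |].
  apply filterlim_comp with (1 := H); destruct l; apply continuous_fst.
- apply (filterlim_ext (fun n => Im (sum_n a n))); [now intros n; rewrite E |].
  apply filterlim_comp with (1 := H); destruct l; apply continuous_snd.
Qed.

Lemma is_series_inner (f g : l2) :
  is_series (fun n => Cmult (f n) (Cconj (g n))) (inner f g).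
Proof.
assert (Hex : ex_series (fun n => Cmult (f n) (Cconj (g n)))).
{ apply (ex_series_le (K := C_AbsRing) (V := C_CompleteNormedModule) _
    (fun n => Cmod (f n) ^ 2 + Cmod (g n) ^ 2)).
  - intros n; change norm with Cmod; rewrite Cmod_mult, Cmod_conj.
    assert (H1 := Cmod_ge_0 (f n)); assert (H2 := Cmod_ge_0 (g n)).
    nra.
  - apply (ex_series_plus (fun n => Cmod (f n) ^ 2)); apply l2_summable. }
destruct Hex as [l Hl].
replace (inner f g) with l; [exact Hl |].
destruct (is_series_C _ _ Hl) as [HR HI]; destruct l as [a b]; unfold inner.
now rewrite (is_series_unique _ _ HR), (is_series_unique _ _ HI).
Qed.

Lemma inner_self (f : l2) : inner f f = RtoC (norm f ^ 2).
Proof.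
change (norm f) with (l2_norm f); rewrite l2_norm_sqr; unfold inner, RtoC.
f_equal.
- apply Series_ext; intros n; rewrite Cmod2_alt; unfold Re, Im; simpl; ring.
- rewrite <- (Rmult_0_l (Series (fun n => Cmod (f n) ^ 2))), <- Series_scal_l.
  apply Series_ext; intros n; unfold Im; simpl; ring.
Qed.

Definition is_adjoint (A B : l2 -> l2) : Prop :=
  is_linear B /\ forall f g : l2, inner (A f) g = inner f (B g).

Lemma is_adjoint_unique (A B B' : l2 -> l2) :
  is_adjoint A B -> is_adjoint A B' -> forall f, B f = B' f.
Proof.
intros [_ HB] [_ HB'] f.
set (d := minus (B f) (B' f)).
assert (Hd : inner d d = RtoC 0).
{ assert (E : inner d (B f) = inner d (B' f)) by now rewrite <- HB, <- HB'.
  destruct (is_series_C _ _ (is_series_inner d (B f))) as [R1 I1].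
  destruct (is_series_C _ _ (is_series_inner d (B' f))) as [R2 I2].
  rewrite E in R1.
  rewrite inner_self.
  assert (Hre : Re (inner d d) = 0).
  { assert (H := is_series_minus _ _ _ _ R1 R2).
    replace (plus _ _) with 0 in H by (symmetry; apply Rplus_opp_r).
    rewrite <- (is_series_unique _ _ H); unfold inner, Re at 1; simpl fst.
    apply Series_ext; intros n.
    unfold d, minus, plus, opp, Re; simpl; ring. }
  rewrite inner_self in Hre.
  exact (f_equal RtoC Hre). }
assert (Hz : norm d = 0).
{ rewrite inner_self in Hd; apply RtoC_inj in Hd.
  apply Rsqr_0_uniq; now rewrite Rsqr_pow2. }
apply norm_eq_zero in Hz; apply l2_eq; intros n.
assert (Hn : Cplus (B f n) (Copp (B' f n)) = RtoC 0)
  by exact (f_equal (fun h : l2 => h n) Hz).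
replace (B f n) with (Cplus (Cplus (B f n) (Copp (B' f n))) (B' f n)) by ring.
rewrite Hn; ring.
Qed.

Definition C_nonneg (z : C) : Prop := 0 <= Re z /\ Im z = 0.

(** The adjoint of a bounded operator exists and is unique
    ([is_adjoint_unique]), so [B] below is the adjoint of [A]. *)
Definition hyponormal (A : l2 -> l2) : Prop :=
  is_linear A /\
  exists B : l2 -> l2, is_adjoint A B /\
    forall f : l2, C_nonneg (inner (minus (B (A f)) (A (B f))) f).

(** The series must converge for every [f] and [i], and its sums must again
    form an element of [l2]. *)
Definition represents (m : nat -> nat -> C) (A : l2 -> l2) : Prop :=
  forall (f : l2) (i : nat), is_series (fun j => Cmult (m i j) (f j)) (A f i).

Definition weighted_mean (w : nat -> R) (i j : nat) : C :=
  RtoC (if (j <=? i)%nat then w j / sum_n w i else 0).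

(* Main.v *)
Require Import Defs.
From Stdlib Require Import Reals Lra Lia FunctionalExtensionality.
From Coquelicot Require Import Coquelicot.
Open Scope R_scope.

(** Write [w n = 2 n + 1], so that [W n = (n + 1)^2]. For real [f] put
    [s n = sum_(j < n) w j f j] and [T n = sum_(i >= n) f i / W i]; then
    [(M f) n = s (n+1) / W n] and [(M* f) n = w n * T n]. Hyponormality says
    [|| M* f || <= || M f ||]. It follows from a quadratic form [X n] in
    [(s n, T n)] with
    [X n - X (n+1) <= ((M f) n)^2 - ((M* f) n)^2],
    [X 0 = 0] and [X N -> 0]: the left side telescopes. The limit holds because
    [N^3 T_N^2] and [s_N^2 / N^3] tend to [0] for square-summable [f].
    Boundedness of [M] is a Hardy inequality proved by the same telescoping,
    with [s_n^2 / n^3] in the role of [X]. *)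

(** * The quadratic form and its one-step inequality *)

(** With [u = T + s / ((2 n + 1)(n + 1)^2)], which changes by a multiple of
    [(M f) n] alone in one step, all terms except [2/9 n (n + 1) u^2] are forced
    by telescoping [((M f) n)^2 - ((M* f) n)^2]; that remaining term is a
    rational subsolution of the Riccati recursion of the resulting Jacobi form.
    The leading coefficient [2/9] is the only admissible one. *)
Definition storage (n s T : R) : R :=
  let u := T + s / ((2 * n + 1) * (n + 1) ^ 2) in
  n * (12 * n ^ 2 + 2 * n - 1) / 9 * u ^ 2
  + 2 * (2 * n + 1) / (n + 1) ^ 2 * (u * s) - s ^ 2 / (n + 1) ^ 4.

Lemma storage_step (n s T f : R) : 0 <= n ->
  storage n s T - storage (n + 1) (s + (2 * n + 1) * f) (T - f / (n + 1) ^ 2)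
  <= ((s + (2 * n + 1) * f) / (n + 1) ^ 2) ^ 2 - ((2 * n + 1) * T) ^ 2.
Proof.
intros Hn.
(* In the variables [g = (M f) n] and [v = u (n+1)], the difference of the two
   sides no longer involves [s]: it is a binary form, here completed to squares. *)
set (g := (s + (2 * n + 1) * f) / (n + 1) ^ 2).
set (D := (2 * n + 1) * (2 * n + 3) * (n + 2) ^ 2).
set (v := (T - f / (n + 1) ^ 2)
          + (s + (2 * n + 1) * f) / ((2 * (n + 1) + 1) * (n + 1 + 1) ^ 2)).
set (e := (n + 1) / 9 * (24 * (n + 1) ^ 3 + 8 * (n + 1) ^ 2 - 9 * (n + 1) - 5)).
(* Up to the positive factor [(n + 1) / (81 * D ^ 2)], [P] is the determinant of the binary form in
   [v] and [g]; the coefficient of [v ^ 2] is [4 * (n + 1) / 9]. *)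
set (P := 480 * (n + 1) ^ 6 + 512 * (n + 1) ^ 5 - 416 * (n + 1) ^ 4
          - 561 * (n + 1) ^ 3 - 10 * (n + 1) ^ 2 + 139 * (n + 1) + 36).
assert (E : g ^ 2 - ((2 * n + 1) * T) ^ 2
    - (storage n s T - storage (n + 1) (s + (2 * n + 1) * f) (T - f / (n + 1) ^ 2))
  = ((4 * (n + 1) / 9 * D * v - e * g) ^ 2 + (n + 1) / 81 * P * g ^ 2)
    / (4 * (n + 1) / 9 * D ^ 2)).
{ unfold P, e, v, D, g, storage; field; repeat split; nra. }
assert (0 <= P).
(* Expanded in [n] instead of [n + 1], all coefficients are positive. *)
{ replace P with (480 * n ^ 6 + 3392 * n ^ 5 + 9344 * n ^ 4 + 12495 * n ^ 3
     + 8131 * n ^ 2 + 2212 * n + 180) by (unfold P; ring).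
  assert (H := fun k => pow_le n k Hn).
  assert (H2 := H 2%nat); assert (H3 := H 3%nat); assert (H4 := H 4%nat).
  assert (H5 := H 5%nat); assert (H6 := H 6%nat); lra. }
assert (0 < D) by (unfold D; repeat apply Rmult_lt_0_compat; lra).
apply Rminus_le_0; rewrite E.
apply Rdiv_le_0_compat.
- apply Rplus_le_le_0_compat; [apply pow2_ge_0 |].
  apply Rmult_le_pos; [| apply pow2_ge_0].
  apply Rmult_le_pos; lra.
- apply Rmult_lt_0_compat; [lra | now apply pow_lt].
Qed.

(** * Partial sums, series of nonnegative terms, and Cauchy-Schwarz *)

Definition sq_summable (a : nat -> R) : Prop := ex_series (fun n => a n ^ 2).

Lemma sum_n_step (a : nat -> R) (n : nat) : sum_n a (S n) = sum_n a n + a (S n).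
Proof. now rewrite sum_Sn. Qed.

Lemma sum_n_telescope_le (d F : nat -> R) (N : nat) :
  (forall n, F n - F (S n) <= d n) -> F 0%nat - F (S N) <= sum_n d N.
Proof.
intros H; induction N as [|N IH]; [now rewrite sum_O |].
rewrite sum_n_step; specialize (H (S N)); lra.
Qed.

Lemma sum_n_diff (c : R) (a b : nat -> R) (N : nat) :
  c * sum_n a N - sum_n b N = sum_n (fun n => c * a n - b n) N.
Proof.
induction N as [|N IH]; [now rewrite !sum_O |].
rewrite !sum_n_step, <- IH; ring.
Qed.

Lemma sum_n_ge_0 (a : nat -> R) (N : nat) :
  (forall n, 0 <= a n) -> 0 <= sum_n a N.
Proof.
intros H; induction N as [|N IH]; [now rewrite sum_O |].
rewrite sum_n_step; specialize (H (S N)); lra.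
Qed.

Lemma sum_n_le_Series (a : nat -> R) (N : nat) :
  (forall n, 0 <= a n) -> ex_series a -> sum_n a N <= Series a.
Proof.
intros Hpos Ha; apply (is_lim_seq_incr_compare (sum_n a)).
- now apply Series_correct.
- intros n; rewrite sum_n_step; specialize (Hpos (S n)); lra.
Qed.

Lemma Series_ge_0 (a : nat -> R) :
  (forall n, 0 <= a n) -> ex_series a -> 0 <= Series a.
Proof.
intros Hpos Ha; apply Rle_trans with (2 := sum_n_le_Series a 0 Hpos Ha).
rewrite sum_O; apply Hpos.
Qed.

Lemma series_le_lim (a b : nat -> R) (l m : R) :
  is_series a l -> is_lim_seq b m -> (forall N, sum_n a N <= b N) -> l <= m.
Proof.
intros Ha Hb H; exact (is_lim_seq_le (sum_n a) b l m H Ha Hb).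
Qed.

Lemma ex_series_bounded (a : nat -> R) (M : R) :
  (forall n, 0 <= a n) -> (forall N, sum_n a N <= M) -> ex_series a.
Proof.
intros Hpos HM.
destruct (ex_finite_lim_seq_incr (sum_n a) M) as [l Hl]; [| exact HM | now exists l].
intros n; rewrite sum_n_step; specialize (Hpos (S n)); lra.
Qed.

Lemma Series_bounded (a : nat -> R) (M : R) :
  (forall n, 0 <= a n) -> (forall N, sum_n a N <= M) -> Series a <= M.
Proof.
intros Hpos HM.
apply (series_le_lim a (fun _ => M)).
- apply Series_correct, (ex_series_bounded a M Hpos HM).
- apply is_lim_seq_const.
- exact HM.
Qed.

Lemma sum_n_Cauchy_Schwarz (x y : nat -> R) (N : nat) :
  sum_n (fun n => x n * y n) N ^ 2
  <= sum_n (fun n => x n ^ 2) N * sum_n (fun n => y n ^ 2) N.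
Proof.
induction N as [|N IH]; [rewrite !sum_O; right; ring |].
rewrite !sum_n_step.
assert (HX := sum_n_ge_0 (fun n => x n ^ 2) N (fun n => pow2_ge_0 (x n))).
assert (HY := sum_n_ge_0 (fun n => y n ^ 2) N (fun n => pow2_ge_0 (y n))).
revert IH HX HY; generalize (sum_n (fun n => x n * y n) N).
generalize (sum_n (fun n => x n ^ 2) N) (sum_n (fun n => y n ^ 2) N).
generalize (x (S N)) (y (S N)); intros p q X Y Z IH HX HY.
(* Only the cross term is left. The induction hypothesis gives [|Z| <= sqrt (X * Y)], and the
   arithmetic-geometric mean inequality for [sqrt X * |q|] and [|p| * sqrt Y] does the rest. *)
cut (2 * Z * (p * q) <= X * q ^ 2 + p ^ 2 * Y); [nra |].
apply Rle_trans with (2 * (sqrt (X * Y) * Rabs (p * q))).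
- apply Rle_trans with (1 := Rle_abs _).
  rewrite Rmult_assoc, !Rabs_mult, (Rabs_pos_eq 2) by lra.
  apply Rmult_le_compat_l; [lra |]; rewrite <- Rabs_mult.
  apply Rmult_le_compat_r; [apply Rabs_pos |].
  rewrite <- sqrt_Rsqr_abs; apply sqrt_le_1_alt; unfold Rsqr; lra.
- rewrite sqrt_mult, Rabs_mult by assumption.
  assert (EX := pow2_sqrt X HX); assert (EY := pow2_sqrt Y HY).
  assert (Ep := pow2_abs p); assert (Eq := pow2_abs q).
  rewrite <- EX at 2; rewrite <- EY at 2; rewrite <- Ep, <- Eq.
  assert (H := pow2_ge_0 (sqrt X * Rabs q - Rabs p * sqrt Y)); lra.
Qed.

Lemma ex_series_mult_sq (x y : nat -> R) :
  sq_summable x -> sq_summable y -> ex_series (fun n => x n * y n).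
Proof.
intros Hx Hy.
apply (ex_series_le (K := R_AbsRing) (V := R_CompleteNormedModule) _
         (fun n => x n ^ 2 + y n ^ 2)).
- intros n; change norm with Rabs; rewrite Rabs_mult.
  rewrite <- (pow2_abs (x n)), <- (pow2_abs (y n)).
  assert (H := pow2_ge_0 (Rabs (x n) - Rabs (y n))).
  assert (Hx2 := pow2_ge_0 (Rabs (x n))); assert (Hy2 := pow2_ge_0 (Rabs (y n))).
  nra.
- exact (ex_series_plus _ _ Hx Hy).
Qed.

Lemma Series_Cauchy_Schwarz (x y : nat -> R) :
  sq_summable x -> sq_summable y ->
  Series (fun n => x n * y n) ^ 2
  <= Series (fun n => x n ^ 2) * Series (fun n => y n ^ 2).
Proof.
intros Hx Hy.
assert (Hxy := Series_correct _ (ex_series_mult_sq x y Hx Hy)).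
apply (is_lim_seq_le (fun N => sum_n (fun n => x n * y n) N ^ 2)
  (fun N => sum_n (fun n => x n ^ 2) N * sum_n (fun n => y n ^ 2) N)
  (Finite _) (Finite _) (sum_n_Cauchy_Schwarz x y)).
- apply (is_lim_seq_ext (fun N => sum_n (fun n => x n * y n) N *
                                  sum_n (fun n => x n * y n) N)).
  { intros n; ring. }
  replace (Series (fun n => x n * y n) ^ 2)
    with (Series (fun n => x n * y n) * Series (fun n => x n * y n)) by ring.
  now apply is_lim_seq_mult'.
- apply is_lim_seq_mult'; now apply Series_correct.
Qed.

(** * Tails of series and the decay of the sum of inverse fourth powers *)

Definition tail (a : nat -> R) (n : nat) : R := Series (fun k => a (n + k)%nat).

Lemma tail_step (a : nat -> R) (n : nat) :
  ex_series a -> tail a n = a n + tail a (S n).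
Proof.
intros Ha; unfold tail.
rewrite Series_incr_1 by now apply ex_series_incr_n.
rewrite Nat.add_0_r; f_equal; apply Series_ext; intros k.
now rewrite Nat.add_succ_r.
Qed.

Lemma tail_lim (a : nat -> R) : ex_series a -> is_lim_seq (tail a) 0.
Proof.
intros Ha; apply is_lim_seq_incr_1.
apply (is_lim_seq_ext (fun n => Series a - sum_n a n)).
{ intros n; induction n as [|n IH].
  - rewrite sum_O, (Series_incr_1 a Ha); unfold tail; simpl; ring.
  - rewrite sum_n_step; rewrite (tail_step a (S n) Ha) in IH; lra. }
replace 0 with (Series a - Series a) by ring.
apply is_lim_seq_minus'; [apply is_lim_seq_const | now apply Series_correct].
Qed.

(** An elementary form of comparing [1 / (x + 1)^4] with the integral of [1 / t^4] over
    [[x, x + 1]], with a factor 3 given away. *)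
Lemma inv_pow4_telescope (x : R) : 0 < x ->
  (/ (x + 1) ^ 2) ^ 2 <= / x ^ 3 - / (x + 1) ^ 3.
Proof.
intros Hx.
replace (/ x ^ 3 - / (x + 1) ^ 3) with
  ((/ (x + 1) ^ 2) ^ 2 * ((3 * x ^ 2 + 3 * x + 1) * (x + 1) * / x ^ 3))
  by (field; lra).
rewrite <- (Rmult_1_r ((/ (x + 1) ^ 2) ^ 2)) at 1.
apply Rmult_le_compat_l; [apply pow2_ge_0 |].
apply Rmult_le_reg_r with (x ^ 3); [now apply pow_lt |].
rewrite Rmult_assoc, Rinv_l by (apply pow_nonzero; lra).
assert (0 < x ^ 3) by now apply pow_lt. nra.
Qed.

Lemma sum_inv_pow4 (n N : nat) : (0 < n)%nat ->
  sum_n (fun k => (/ (INR (n + k) + 1) ^ 2) ^ 2) N <= / INR n ^ 3.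
Proof.
intros Hn; assert (Hn' := lt_0_INR n Hn).
assert (Hpos : forall k, 0 < INR (n + k)) by (intros k; apply lt_0_INR; lia).
(* The telescoped end term is kept so that the induction closes. *)
cut (sum_n (fun k => (/ (INR (n + k) + 1) ^ 2) ^ 2) N
     <= / INR n ^ 3 - / INR (n + S N) ^ 3).
{ assert (H := Rinv_0_lt_compat _ (pow_lt _ 3 (Hpos (S N)))); lra. }
induction N as [|N IH].
- rewrite sum_O, Nat.add_0_r, Nat.add_1_r, S_INR; now apply inv_pow4_telescope.
- rewrite sum_n_step.
  assert (H := inv_pow4_telescope _ (Hpos (S N))).
  rewrite <- S_INR in H at 2; rewrite <- Nat.add_succ_r in H; lra.
Qed.

Lemma sq_summable_inv_sq : sq_summable (fun k => / (INR k + 1) ^ 2).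
Proof.
(* Index 0 is split off because [sum_inv_pow4] starts at a positive index. *)
apply ex_series_incr_1.
apply (ex_series_bounded _ (/ INR 1 ^ 3)).
- intros n; apply pow2_ge_0.
- intros N; exact (sum_inv_pow4 1 N Nat.lt_0_1).
Qed.

(** * The real sequences [s], [M f], [T], [M* f] as [odd_sum], [odd_mean], [scaled_tail],
    [odd_mean_adj], and their decay *)

Fixpoint odd_sum (a : nat -> R) (n : nat) : R :=
  match n with
  | O => 0
  | S k => odd_sum a k + (2 * INR k + 1) * a k
  end.

Definition odd_mean (a : nat -> R) (n : nat) : R :=
  odd_sum a (S n) / (INR n + 1) ^ 2.

Definition scaled_tail (a : nat -> R) (n : nat) : R :=
  tail (fun k => a k / (INR k + 1) ^ 2) n.

Definition odd_mean_adj (a : nat -> R) (n : nat) : R :=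
  (2 * INR n + 1) * scaled_tail a n.

Lemma ex_series_scaled (a : nat -> R) :
  sq_summable a -> ex_series (fun k => a k / (INR k + 1) ^ 2).
Proof. intros Ha; exact (ex_series_mult_sq a _ Ha sq_summable_inv_sq). Qed.

Lemma scaled_tail_step (a : nat -> R) (n : nat) : sq_summable a ->
  scaled_tail a n = a n / (INR n + 1) ^ 2 + scaled_tail a (S n).
Proof. intros Ha; exact (tail_step _ n (ex_series_scaled a Ha)). Qed.

(** Cauchy-Schwarz on the indices from [n] on, where the squared weights [1 / (k + 1)^4] sum to at
    most [1 / n^3]. Keeping the tail of [a ^ 2] instead of its full sum is what makes the left side
    tend to 0. *)
Lemma scaled_tail_bound (a : nat -> R) (n : nat) :
  sq_summable a -> (0 < n)%nat ->
  INR n ^ 3 * scaled_tail a n ^ 2 <= tail (fun k => a k ^ 2) n.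
Proof.
intros Ha Hn; assert (Hn' := pow_lt _ 3 (lt_0_INR n Hn)).
assert (Ha' : sq_summable (fun k => a (n + k)%nat))
  by now apply (ex_series_incr_n (fun k => a k ^ 2)).
assert (Hw : sq_summable (fun k => / (INR (n + k) + 1) ^ 2))
  by exact (proj1 (ex_series_incr_n (fun k => (/ (INR k + 1) ^ 2) ^ 2) n)
              sq_summable_inv_sq).
assert (H := Series_Cauchy_Schwarz _ _ Ha' Hw).
assert (HW := Series_bounded (fun k => (/ (INR (n + k) + 1) ^ 2) ^ 2)
  (/ INR n ^ 3) (fun k => pow2_ge_0 _) (fun N => sum_inv_pow4 n N Hn)).
assert (HE := Series_ge_0 (fun k => a (n + k)%nat ^ 2)
                (fun k => pow2_ge_0 _) Ha').
change (Series (fun k => a (n + k)%nat * / (INR (n + k) + 1) ^ 2))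
  with (scaled_tail a n) in H.
unfold tail.
apply Rmult_le_reg_l with (/ INR n ^ 3); [now apply Rinv_0_lt_compat |].
rewrite <- Rmult_assoc, Rinv_l, Rmult_1_l by lra.
apply Rle_trans with (1 := H); rewrite Rmult_comm.
now apply Rmult_le_compat_r.
Qed.

(* At [n = 0] the quotient [odd_sum a 0 ^ 2 / INR 0 ^ 2] is [0]. *)
Lemma odd_sum_sq_step (a : nat -> R) (n : nat) :
  odd_sum a (S n) ^ 2 / INR (S n) ^ 2
  <= odd_sum a n ^ 2 / INR n ^ 2 + (2 * INR n + 1) * a n ^ 2.
Proof.
rewrite S_INR; change (odd_sum a (S n)) with (odd_sum a n + (2 * INR n + 1) * a n).
destruct (Nat.eq_0_gt_0_cases n) as [-> | Hn].
- simpl odd_sum; simpl INR; 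
  replace (0 ^ 2 / 0 ^ 2) with 0 by (unfold Rdiv; ring); right; field.
- apply lt_0_INR in Hn; revert Hn.
  generalize (odd_sum a n) (a n) (INR n); intros s f x Hx.
  apply Rminus_le_0.
  (* Convexity of the square: the weights [x ^ 2] and [2 * x + 1] add up to [(x + 1) ^ 2], and the
     defect is the weighted variance of [s / x ^ 2] and [f]. *)
  replace (_ - _) with
    ((2 * x + 1) * (x * (s / x ^ 2 - f) / (x + 1)) ^ 2) by (field; lra).
  apply Rmult_le_pos; [lra | apply pow2_ge_0].
Qed.

(** By [odd_sum_sq_step], [h] grows by at most [(2 n + 1) (a n)^2] per step. Summed from a fixed
    [K], this bounds [h n / n] by [h K / n] plus twice the tail of [a ^ 2] at [K]. First [K] is
    chosen to make the tail small, then [n] to make [h K / n] small. *)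
Lemma odd_sum_sq_lim (a : nat -> R) :
  sq_summable a -> is_lim_seq (fun n => odd_sum a n ^ 2 / INR n ^ 3) 0.
Proof.
intros Ha.
set (h := fun n => odd_sum a n ^ 2 / INR n ^ 2).
set (E := tail (fun k => a k ^ 2)).
assert (HE : forall n, E n = a n ^ 2 + E (S n)) by (intros n; now apply tail_step).
assert (HE0 : forall n, 0 <= E n).
{ intros n; apply Series_ge_0; [intros k; apply pow2_ge_0 |].
  now apply (ex_series_incr_n (fun k => a k ^ 2)). }
assert (Hh : forall K k, h (K + k)%nat <= h K + 2 * INR (K + k) * (E K - E (K + k)%nat)).
{ intros K; induction k as [|k IH]; [rewrite Nat.add_0_r; lra |].
  rewrite Nat.add_succ_r.
  assert (H1 := odd_sum_sq_step a (K + k)).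
  fold (h (S (K + k))) (h (K + k)%nat) in H1.
  assert (H2 := HE (K + k)%nat); rewrite S_INR.
  assert (H3 := pow2_ge_0 (a (K + k)%nat)).
  assert (0 <= E K - E (K + k)%nat).
  { clear -HE; induction k as [|k IH]; [rewrite Nat.add_0_r; lra |].
    rewrite Nat.add_succ_r.
    assert (H := HE (K + k)%nat); assert (H3 := pow2_ge_0 (a (K + k)%nat)); lra. }
  assert (H4 := pos_INR (K + k)).
  replace (E (S (K + k))) with (E (K + k)%nat - a (K + k)%nat ^ 2) by lra.
  nra. }
apply is_lim_seq_spec; intros eps.
change (eventually (fun n => Rabs (odd_sum a n ^ 2 / INR n ^ 3 - 0) < eps)).
assert (HE' := proj2 (is_lim_seq_spec _ _) (tail_lim _ Ha)).
(* With [eps / 4] the tail contributes less than [eps / 2]; the choice of [N] below leaves [eps / 2]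
   for [h K / n]. *)
destruct (HE' (mkposreal (eps / 4) ltac:(destruct eps; simpl; lra))) as [K HK].
specialize (HK K (Nat.le_refl K)); fold E in HK; simpl in HK.
rewrite Rminus_0_r in HK.
assert (HK2 : E K < eps / 4) by (apply Rle_lt_trans with (2 := HK), Rle_abs).
destruct (INR_unbounded (2 * h K / eps)) as [N HN].
exists (S (K + N))%nat; intros n Hn.
assert (Hn0 : 0 < INR n) by (apply lt_0_INR; lia).
assert (HNn : INR N <= INR n) by (apply le_INR; lia).
assert (Heps := cond_pos eps).
rewrite Rminus_0_r, Rabs_pos_eq.
2:{ apply Rdiv_le_0_compat; [apply pow2_ge_0 | now apply pow_lt]. }
replace (odd_sum a n ^ 2 / INR n ^ 3) with (h n / INR n) by (unfold h; field; lra).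
apply Rmult_lt_reg_r with (INR n); [exact Hn0 |].
unfold Rdiv; rewrite Rmult_assoc, Rinv_l, Rmult_1_r by lra.
assert (H := Hh K (n - K)%nat); replace (K + (n - K))%nat with n in H by lia.
apply Rle_lt_trans with (1 := H).
assert (H5 := HE0 n).
assert (H6 : 2 * h K < eps * INR n).
{ apply Rmult_lt_reg_r with (/ eps); [now apply Rinv_0_lt_compat |].
  replace (eps * INR n * / eps) with (INR n) by (field; lra).
  change (2 * h K / eps < INR n); lra. }
nra.
Qed.

(** * The Hardy inequality and boundedness of [M] *)

(** Multiply [odd_sum_sq_step] by [(n + 2) / (n + 1)^2 = 1 / (n + 1) + 1 / (n + 1)^2]. The left side
    splits into the next boundary term and [odd_mean a n ^ 2]. On the right,
    [n (n + 2) <= (n + 1)^2] recovers the old boundary term, and the coefficient of [a n ^ 2] stays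
    below [5 / 2]. *)
Lemma odd_mean_Hardy (a : nat -> R) (N : nat) :
  sum_n (fun n => odd_mean a n ^ 2) N <= 5 / 2 * sum_n (fun n => a n ^ 2) N.
Proof.
set (F := fun n => - (odd_sum a n ^ 2 / INR n ^ 3)).
assert (H : F 0%nat - F (S N)
  <= sum_n (fun n => 5 / 2 * a n ^ 2 - odd_mean a n ^ 2) N).
{ apply sum_n_telescope_le; intros n; unfold F.
  assert (H := odd_sum_sq_step a n); assert (Hn := pos_INR n).
  assert (H3 := pow2_ge_0 (a n)).
  assert (Hx : odd_sum a n ^ 2 / INR n ^ 2 * ((INR n + 2) / (INR n + 1) ^ 2)
               <= odd_sum a n ^ 2 / INR n ^ 3).
  (* At [n = 0] both sides vanish because [odd_sum a 0 = 0]. *)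
  { destruct (Nat.eq_0_gt_0_cases n) as [-> | Hn']; [simpl; right; unfold Rdiv; ring |].
    apply lt_0_INR in Hn'.
    replace (odd_sum a n ^ 2 / INR n ^ 3)
      with (odd_sum a n ^ 2 / INR n ^ 2 * / INR n) by (field; lra).
    apply Rmult_le_compat_l.
    { apply Rdiv_le_0_compat; [apply pow2_ge_0 | now apply pow_lt]. }
    apply Rminus_le_0; replace (_ - _) with (/ (INR n * (INR n + 1) ^ 2))
      by (field; lra).
    left; apply Rinv_0_lt_compat, Rmult_lt_0_compat; [lra | apply pow_lt; lra]. }
  assert (Hc : 0 <= (INR n + 2) / (INR n + 1) ^ 2)
    by (apply Rdiv_le_0_compat; [lra | apply pow_lt; lra]).
  assert (Hy := Rmult_le_compat_r _ _ _ Hc H).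
  assert (Hz : (2 * INR n + 1) * ((INR n + 2) / (INR n + 1) ^ 2) <= 5 / 2).
  { apply Rminus_le_0.
    replace (_ - _) with ((INR n ^ 2 + 1) / (2 * (INR n + 1) ^ 2))
      by (field; lra).
    apply Rdiv_le_0_compat; [assert (H' := pow2_ge_0 (INR n)); lra |].
    apply Rmult_lt_0_compat; [lra | apply pow_lt; lra]. }
  replace (odd_mean a n ^ 2) with
    (odd_sum a (S n) ^ 2 / INR (S n) ^ 2 * ((INR n + 2) / (INR n + 1) ^ 2)
      - odd_sum a (S n) ^ 2 / INR (S n) ^ 3)
    by (unfold odd_mean; rewrite S_INR; field; lra).
  assert (Hw := Rmult_le_compat_r _ _ _ H3 Hz); lra. }
assert (F 0%nat = 0) by (unfold F, Rdiv; simpl odd_sum; ring).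
assert (F (S N) <= 0).
{ unfold F; apply Rge_le, Ropp_0_le_ge_contravar, Rdiv_le_0_compat.
  - apply pow2_ge_0.
  - apply pow_lt, lt_0_INR; lia. }
rewrite <- sum_n_diff in H; lra.
Qed.

Lemma odd_mean_sq_summable (a : nat -> R) :
  sq_summable a -> sq_summable (odd_mean a).
Proof.
intros Ha; apply (ex_series_bounded _ (5 / 2 * Series (fun n => a n ^ 2))).
- intros n; apply pow2_ge_0.
- intros N; apply Rle_trans with (1 := odd_mean_Hardy a N).
  apply Rmult_le_compat_l; [lra |].
  apply (sum_n_le_Series (fun n => a n ^ 2)); [intros n; apply pow2_ge_0 | exact Ha].
Qed.

Lemma odd_mean_norm_le (a : nat -> R) : sq_summable a ->
  Series (fun n => odd_mean a n ^ 2) <= 5 / 2 * Series (fun n => a n ^ 2).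
Proof.
intros Ha; apply Series_bounded; [intros n; apply pow2_ge_0 |].
intros N; apply Rle_trans with (1 := odd_mean_Hardy a N).
apply Rmult_le_compat_l; [lra |].
apply (sum_n_le_Series (fun n => a n ^ 2)); [intros n; apply pow2_ge_0 | exact Ha].
Qed.

(** * Comparison of the norms of [M* f] and [M f] *)

(** The end value of [storage] enters the telescoped inequality with a minus sign, so an upper bound
    suffices. It comes from [u^2 <= 2 T^2 + 2 (s / d)^2] with [d >= 2 n^3], and from splitting
    [u * s] with the weights [n^3] and [1 / n^3]; the constants are generous. *)
Lemma storage_le (n s T : R) : 1 <= n ->
  storage n s T <= 8 * (n ^ 3 * T ^ 2) + 4 * (s ^ 2 / n ^ 3).
Proof.
intros Hn; unfold storage.
set (d := (2 * n + 1) * (n + 1) ^ 2).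
set (u := T + s / d).
assert (Hn3 : 0 < n ^ 3) by (apply pow_lt; lra).
assert (Hd : 2 * n ^ 3 <= d) by (unfold d; nra).
set (h := s ^ 2 / n ^ 3).
assert (Hh : 0 <= h) by (apply Rdiv_le_0_compat; [apply pow2_ge_0 | exact Hn3]).
assert (Hu : n ^ 3 * u ^ 2 <= 2 * (n ^ 3 * T ^ 2) + h / 2).
{ assert (Hs : n ^ 3 * (s / d) ^ 2 <= h / 4).
  { replace (h / 4) with (n ^ 3 * (s ^ 2 * / (2 * n ^ 3) ^ 2))
      by (unfold h; field; lra).
    unfold Rdiv; rewrite Rpow_mult_distr, pow_inv.
    apply Rmult_le_compat_l; [lra |].
    apply Rmult_le_compat_l; [apply pow2_ge_0 |].
    apply Rinv_le_contravar; [apply pow_lt; lra |].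
    apply pow_incr; lra. }
  assert (H := Rmult_le_pos _ _ (Rlt_le _ _ Hn3) (pow2_ge_0 (T - s / d))).
  unfold u; lra. }
assert (Hus : 2 * (2 * n + 1) / (n + 1) ^ 2 * (u * s) <= 2 * (n ^ 3 * u ^ 2 + h)).
{ assert (Hk : 0 <= 2 * (2 * n + 1) / (n + 1) ^ 2 <= 2).
  { split; [apply Rdiv_le_0_compat; [lra | apply pow_lt; lra] |].
    apply Rminus_le_0; replace (_ - _) with (2 * (n ^ 2 / (n + 1) ^ 2)) by (field; lra).
    apply Rmult_le_pos; [lra |]; apply Rdiv_le_0_compat; [apply pow2_ge_0 | apply pow_lt; lra]. }
  assert (H1 : u * s <= n ^ 3 * u ^ 2 + h).
  { replace (n ^ 3 * u ^ 2 + h) with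
      (u * s + n ^ 3 * ((u - s / n ^ 3 / 2) ^ 2 + 3 / 4 * (s / n ^ 3) ^ 2))
      by (unfold h; field; lra).
    rewrite <- (Rplus_0_r (u * s)) at 1; apply Rplus_le_compat_l.
    apply Rmult_le_pos; [lra |].
    assert (H1 := pow2_ge_0 (u - s / n ^ 3 / 2)).
    assert (H2 := pow2_ge_0 (s / n ^ 3)); lra. }
  assert (0 <= n ^ 3 * u ^ 2) by (apply Rmult_le_pos; [lra | apply pow2_ge_0]).
  apply Rle_trans with (2 * (2 * n + 1) / (n + 1) ^ 2 * (n ^ 3 * u ^ 2 + h)).
  - now apply Rmult_le_compat_l.
  - apply Rmult_le_compat_r; lra. }
assert (Hc : n * (12 * n ^ 2 + 2 * n - 1) / 9 * u ^ 2 <= 2 * (n ^ 3 * u ^ 2)).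
{ rewrite <- Rmult_assoc; apply Rmult_le_compat_r; [apply pow2_ge_0 |]; nra. }
assert (0 <= s ^ 2 / (n + 1) ^ 4)
  by (apply Rdiv_le_0_compat; [apply pow2_ge_0 | apply pow_lt; lra]).
lra.
Qed.

Lemma odd_mean_adj_partial (a : nat -> R) (N : nat) : sq_summable a ->
  sum_n (fun n => odd_mean_adj a n ^ 2) N
  <= sum_n (fun n => odd_mean a n ^ 2) N
     + (8 * tail (fun k => a k ^ 2) (S N)
        + 4 * (odd_sum a (S N) ^ 2 / INR (S N) ^ 3)).
Proof.
intros Ha.
assert (H : storage 0 0 (scaled_tail a 0)
   - storage (INR (S N)) (odd_sum a (S N)) (scaled_tail a (S N))
  <= sum_n (fun n => 1 * odd_mean a n ^ 2 - odd_mean_adj a n ^ 2) N).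
{ apply (sum_n_telescope_le _
    (fun n => storage (INR n) (odd_sum a n) (scaled_tail a n))); intros n.
  assert (H := storage_step (INR n) (odd_sum a n) (scaled_tail a n) (a n) (pos_INR n)).
  rewrite S_INR; unfold odd_mean, odd_mean_adj; simpl odd_sum.
  replace (scaled_tail a (S n)) with (scaled_tail a n - a n / (INR n + 1) ^ 2)
    by (rewrite (scaled_tail_step a n Ha); ring).
  lra. }
(* Every term of [storage] has a factor [n] or [s]. *)
assert (E0 : storage 0 0 (scaled_tail a 0) = 0) by (unfold storage; field).
assert (HN : 1 <= INR (S N)) by (rewrite S_INR; assert (H' := pos_INR N); lra).
assert (H1 := storage_le _ (odd_sum a (S N)) (scaled_tail a (S N)) HN).
assert (H2 := scaled_tail_bound a (S N) Ha (Nat.lt_0_succ N)).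
rewrite <- sum_n_diff in H; lra.
Qed.

Lemma boundary_lim (a : nat -> R) : sq_summable a ->
  is_lim_seq (fun N => 8 * tail (fun k => a k ^ 2) (S N)
        + 4 * (odd_sum a (S N) ^ 2 / INR (S N) ^ 3)) 0.
Proof.
intros Ha; replace 0 with (8 * 0 + 4 * 0) by ring.
apply is_lim_seq_plus'; apply is_lim_seq_mult'; try apply is_lim_seq_const.
- exact (proj1 (is_lim_seq_incr_1 _ _) (tail_lim _ Ha)).
- exact (proj1 (is_lim_seq_incr_1 _ _) (odd_sum_sq_lim a Ha)).
Qed.

(** Boundedness of the adjoint comes from the telescoped estimate itself: its boundary terms
    converge, hence are bounded, and the rest is controlled by the Hardy inequality. *)
Lemma odd_mean_adj_sq_summable (a : nat -> R) :
  sq_summable a -> sq_summable (odd_mean_adj a).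
Proof.
intros Ha.
destruct (filterlim_bounded (K := R_AbsRing) (V := R_NormedModule) _
  (ex_intro _ 0 (boundary_lim a Ha))) as [K HK].
apply (ex_series_bounded _ (Series (fun n => odd_mean a n ^ 2) + K)).
- intros n; apply pow2_ge_0.
- intros N; apply Rle_trans with (1 := odd_mean_adj_partial a N Ha).
  apply Rplus_le_compat.
  + apply (sum_n_le_Series (fun n => odd_mean a n ^ 2));
      [intros n; apply pow2_ge_0 | now apply odd_mean_sq_summable].
  + apply Rle_trans with (1 := Rle_abs _); exact (HK N).
Qed.

Lemma odd_mean_adj_norm_le (a : nat -> R) : sq_summable a ->
  Series (fun n => odd_mean_adj a n ^ 2) <= Series (fun n => odd_mean a n ^ 2).
Proof.
intros Ha.
apply (series_le_lim (fun n => odd_mean_adj a n ^ 2)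
  (fun N => sum_n (fun n => odd_mean a n ^ 2) N
     + (8 * tail (fun k => a k ^ 2) (S N)
        + 4 * (odd_sum a (S N) ^ 2 / INR (S N) ^ 3)))).
- now apply Series_correct, odd_mean_adj_sq_summable.
- rewrite <- (Rplus_0_r (Series _)); apply is_lim_seq_plus'; [| now apply boundary_lim].
  now apply Series_correct, odd_mean_sq_summable.
- intros N; now apply odd_mean_adj_partial.
Qed.

(** * The adjoint relation on real sequences *)

(** Summation by parts: the partial sums of the two series differ by the boundary product
    [s_(N+1) T_(N+1)]. It tends to 0, being at most [s^2 / n^3 + n^3 T^2] in absolute value at
    [n = N + 1]. *)
Lemma odd_mean_adjoint (a c : nat -> R) : sq_summable a -> sq_summable c ->
  Series (fun n => odd_mean a n * c n) = Series (fun n => a n * odd_mean_adj c n).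
Proof.
intros Ha Hc.
assert (H1 := Series_correct _ (ex_series_mult_sq _ _ (odd_mean_sq_summable a Ha) Hc)).
assert (H2 := Series_correct _ (ex_series_mult_sq _ _ Ha (odd_mean_adj_sq_summable c Hc))).
assert (E : forall N, sum_n (fun n => a n * odd_mean_adj c n) N
   - sum_n (fun n => odd_mean a n * c n) N = odd_sum a (S N) * scaled_tail c (S N)).
{ intros N; cut (forall n, a n * odd_mean_adj c n - odd_mean a n * c n
    = odd_sum a (S n) * scaled_tail c (S n) - odd_sum a n * scaled_tail c n).
  - intros Hs; induction N as [|N IH].
    + rewrite !sum_O, Hs; simpl; ring.
    + rewrite !sum_n_step; specialize (Hs (S N)); lra.
  - intros n; unfold odd_mean_adj, odd_mean.
    rewrite (scaled_tail_step c n Hc); simpl odd_sum; field.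
    assert (H := pos_INR n); lra. }
assert (L : is_lim_seq (fun N => odd_sum a (S N) * scaled_tail c (S N)) 0).
{ apply is_lim_seq_abs_0.
  apply (is_lim_seq_le_le (fun _ => 0) _ (fun N => odd_sum a (S N) ^ 2 / INR (S N) ^ 3
                      + tail (fun k => c k ^ 2) (S N))).
  - intros N; split; [apply Rabs_pos |].
    assert (H := scaled_tail_bound c (S N) Hc (Nat.lt_0_succ N)).
    assert (Hx : 0 < INR (S N) ^ 3) by (apply pow_lt, lt_0_INR; lia).
    apply Rle_trans with (odd_sum a (S N) ^ 2 / INR (S N) ^ 3
        + INR (S N) ^ 3 * scaled_tail c (S N) ^ 2); [| lra].
    revert Hx; generalize (INR (S N) ^ 3) (odd_sum a (S N)) (scaled_tail c (S N)).
    intros x s t Hx.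
    assert (P1 : s ^ 2 / x + x * t ^ 2 - s * t
       = x * ((t - s / x / 2) ^ 2 + 3 / 4 * (s / x) ^ 2)) by (field; lra).
    assert (P2 : s ^ 2 / x + x * t ^ 2 + s * t
       = x * ((t + s / x / 2) ^ 2 + 3 / 4 * (s / x) ^ 2)) by (field; lra).
    assert (Q0 := pow2_ge_0 (s / x)).
    assert (Q1 : 0 <= x * ((t - s / x / 2) ^ 2 + 3 / 4 * (s / x) ^ 2)).
    { apply Rmult_le_pos; [lra |]; assert (Q := pow2_ge_0 (t - s / x / 2)); lra. }
    assert (Q2 : 0 <= x * ((t + s / x / 2) ^ 2 + 3 / 4 * (s / x) ^ 2)).
    { apply Rmult_le_pos; [lra |]; assert (Q := pow2_ge_0 (t + s / x / 2)); lra. }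
    apply Rabs_le; lra.
  - apply is_lim_seq_const.
  - replace 0 with (0 + 0) by ring; apply is_lim_seq_plus'.
    + exact (proj1 (is_lim_seq_incr_1 _ _) (odd_sum_sq_lim a Ha)).
    + exact (proj1 (is_lim_seq_incr_1 _ _) (tail_lim _ Hc)). }
assert (L' := is_lim_seq_minus' _ _ _ _ H2 H1).
apply (is_lim_seq_ext _ _ _ E) in L'.
apply is_lim_seq_unique in L; apply is_lim_seq_unique in L'.
rewrite L in L'; injection L'; lra.
Qed.

(** * Passage from real sequences to complex [l2] *)

Definition re_seq (f : l2) (n : nat) : R := Re (f n).
Definition im_seq (f : l2) (n : nat) : R := Im (f n).

Lemma Cmod_pair_sqr (x y : R) : Cmod (x, y) ^ 2 = x ^ 2 + y ^ 2.
Proof. rewrite Cmod2_alt; reflexivity. Qed.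

Lemma re_seq_sq_summable (f : l2) : sq_summable (re_seq f).
Proof.
apply (ex_series_le (K := R_AbsRing) (V := R_CompleteNormedModule) _
         (fun n => Cmod (f n) ^ 2)); [| apply l2_summable].
intros n; change norm with Rabs; rewrite Rabs_pos_eq by apply pow2_ge_0.
rewrite Cmod2_alt; assert (H := pow2_ge_0 (Im (f n))); unfold re_seq; lra.
Qed.

Lemma im_seq_sq_summable (f : l2) : sq_summable (im_seq f).
Proof.
apply (ex_series_le (K := R_AbsRing) (V := R_CompleteNormedModule) _
         (fun n => Cmod (f n) ^ 2)); [| apply l2_summable].
intros n; change norm with Rabs; rewrite Rabs_pos_eq by apply pow2_ge_0.
rewrite Cmod2_alt; assert (H := pow2_ge_0 (Re (f n))); unfold im_seq; lra.
Qed.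

Lemma l2_norm_sqr_re_im (f : l2) :
  l2_norm f ^ 2 = Series (fun n => re_seq f n ^ 2) + Series (fun n => im_seq f n ^ 2).
Proof.
rewrite l2_norm_sqr, <- Series_plus;
  [| apply re_seq_sq_summable | apply im_seq_sq_summable].
apply Series_ext; intros n; apply Cmod2_alt.
Qed.

Definition preserves_sq_summable (L : (nat -> R) -> nat -> R) : Prop :=
  forall a, sq_summable a -> sq_summable (L a).

(** Restricted to square-summable sequences because [odd_mean_adj] is built from [Series], which is
    additive only where it converges. *)
Definition preserves_combinations (L : (nat -> R) -> nat -> R) : Prop :=
  forall (a b : nat -> R) (x y : R) (n : nat), sq_summable a -> sq_summable b ->
  L (fun k => x * a k + y * b k) n = x * L a n + y * L b n.

Lemma complexify_summable (L : (nat -> R) -> nat -> R) (f : l2) :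
  preserves_sq_summable L ->
  ex_series (fun n => Cmod (L (re_seq f) n, L (im_seq f) n) ^ 2).
Proof.
intros HL.
apply (ex_series_ext (fun n => L (re_seq f) n ^ 2 + L (im_seq f) n ^ 2)).
{ intros n; now rewrite Cmod_pair_sqr. }
apply (ex_series_plus (fun n => L (re_seq f) n ^ 2)); apply HL.
- apply re_seq_sq_summable.
- apply im_seq_sq_summable.
Qed.

(** A real matrix acts separately on real and imaginary parts, so the analysis can stay with real
    sequences. *)
Definition complexify (L : (nat -> R) -> nat -> R) (HL : preserves_sq_summable L)
  (f : l2) : l2 :=
  mk_l2 (fun n => (L (re_seq f) n, L (im_seq f) n)) (complexify_summable L f HL).

(** A complex scalar mixes real and imaginary parts, whence the two-term combinations in
    [preserves_combinations]. The norm bound is the sum of the real bounds for the two parts. *)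
Lemma complexify_linear (L : (nat -> R) -> nat -> R) (HL : preserves_sq_summable L)
  (K : R) : 0 < K ->
  preserves_combinations L ->
  (forall a, sq_summable a ->
     Series (fun n => L a n ^ 2) <= K ^ 2 * Series (fun n => a n ^ 2)) ->
  is_linear (complexify L HL).
Proof.
intros HK Hlin Hbd; split.
- intros f g; apply l2_eq; intros n; simpl.
  change (L (re_seq (plus f g))) with (L (fun k => re_seq f k + re_seq g k)).
  change (L (im_seq (plus f g))) with (L (fun k => im_seq f k + im_seq g k)).
  assert (E : forall a b, sq_summable a -> sq_summable b ->
    L (fun k => a k + b k) n = L a n + L b n).
  { intros a b Ha Hb; rewrite <- (Rmult_1_l (L a n)), <- (Rmult_1_l (L b n)).
    rewrite <- Hlin by assumption; f_equal.
    apply functional_extensionality; intros k; ring. }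
  rewrite !E by (apply re_seq_sq_summable || apply im_seq_sq_summable).
  reflexivity.
- intros [x y] f; apply l2_eq; intros n; simpl.
  replace (re_seq (scal _ f)) with (fun k => x * re_seq f k + - y * im_seq f k)
    by (apply functional_extensionality; intros k;
        unfold re_seq, im_seq, Re, Im; simpl; ring).
  replace (im_seq (scal _ f)) with (fun k => x * im_seq f k + y * re_seq f k)
    by (apply functional_extensionality; intros k;
        unfold re_seq, im_seq, Re, Im; simpl; ring).
  rewrite !Hlin by (apply re_seq_sq_summable || apply im_seq_sq_summable).
  unfold Cmult; simpl; f_equal; ring.
- exists K; split; [exact HK |]; intros f.
  change (l2_norm (complexify L HL f) <= K * l2_norm f).
  assert (Hf := l2_norm_ge_0 f).
  apply Rsqr_incr_0_var; [| apply Rmult_le_pos; lra].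
  rewrite !Rsqr_pow2, Rpow_mult_distr, !l2_norm_sqr_re_im.
  assert (H1 := Hbd _ (re_seq_sq_summable f)).
  assert (H2 := Hbd _ (im_seq_sq_summable f)).
  change (re_seq (complexify L HL f)) with (L (re_seq f)).
  change (im_seq (complexify L HL f)) with (L (im_seq f)); lra.
Qed.

Lemma C_eq (z z' : C) : Re z = Re z' -> Im z = Im z' -> z = z'.
Proof. destruct z, z'; unfold Re, Im; simpl; congruence. Qed.

Lemma Re_inner (f g : l2) : Re (inner f g) =
  Series (fun n => re_seq f n * re_seq g n) + Series (fun n => im_seq f n * im_seq g n).
Proof.
rewrite <- Series_plus; [| apply ex_series_mult_sq ..];
  try apply re_seq_sq_summable; try apply im_seq_sq_summable.
apply Series_ext; intros n; unfold re_seq, im_seq, Re, Im; simpl; ring.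
Qed.

Lemma Im_inner (f g : l2) : Im (inner f g) =
  Series (fun n => im_seq f n * re_seq g n) - Series (fun n => re_seq f n * im_seq g n).
Proof.
rewrite <- Series_minus; [| apply ex_series_mult_sq ..];
  try apply re_seq_sq_summable; try apply im_seq_sq_summable.
apply Series_ext; intros n; unfold re_seq, im_seq, Re, Im; simpl; ring.
Qed.

Lemma inner_conj (f g : l2) : inner g f = Cconj (inner f g).
Proof.
assert (C : forall a b : nat -> R,
  Series (fun n => a n * b n) = Series (fun n => b n * a n))
  by (intros a b; apply Series_ext; intros n; ring).
apply C_eq.
- change (Re (inner g f) = Re (inner f g)); rewrite !Re_inner.
  now rewrite (C (re_seq g)), (C (im_seq g)).
- change (Im (inner g f) = - Im (inner f g)); rewrite !Im_inner.
  rewrite (C (im_seq g)), (C (re_seq g)); ring.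
Qed.

Lemma inner_minus_l (f g h : l2) :
  inner (minus f g) h = Cminus (inner f h) (inner g h).
Proof.
unfold inner, Cminus, Cplus, Copp; simpl fst; simpl snd.
assert (Hf := is_series_C _ _ (is_series_inner f h)).
assert (Hg := is_series_C _ _ (is_series_inner g h)).
destruct Hf as [Hf1 Hf2], Hg as [Hg1 Hg2].
f_equal;
  [ eapply eq_trans; [| exact (Series_minus _ _ (ex_intro _ _ Hf1) (ex_intro _ _ Hg1))]
  | eapply eq_trans; [| exact (Series_minus _ _ (ex_intro _ _ Hf2) (ex_intro _ _ Hg2))] ];
  apply Series_ext; intros n; unfold minus, Re, Im; simpl; ring.
Qed.

(** The real and imaginary parts of [inner] consist of four real pairings, and the real identity
    applies to each. *)
Lemma complexify_adjoint (L L' : (nat -> R) -> nat -> R)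
  (HL : preserves_sq_summable L) (HL' : preserves_sq_summable L') (f g : l2) :
  (forall a c, sq_summable a -> sq_summable c ->
     Series (fun n => L a n * c n) = Series (fun n => a n * L' c n)) ->
  inner (complexify L HL f) g = inner f (complexify L' HL' g).
Proof.
intros H.
assert (Hf := re_seq_sq_summable f); assert (Hf' := im_seq_sq_summable f).
assert (Hg := re_seq_sq_summable g); assert (Hg' := im_seq_sq_summable g).
apply C_eq.
- rewrite !Re_inner; f_equal; now apply H.
- rewrite !Im_inner; unfold Rminus; f_equal; [| f_equal]; now apply H.
Qed.

(** * The matrix of [M] and its hyponormality *)

Lemma odd_mean_combinations : preserves_combinations odd_mean.
Proof.
intros a b x y n _ _; unfold odd_mean.
assert (E : forall m, odd_sum (fun k => x * a k + y * b k) m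
                      = x * odd_sum a m + y * odd_sum b m).
{ induction m as [|m IH]; simpl; [ring | rewrite IH; ring]. }
rewrite E; unfold Rdiv; ring.
Qed.

Lemma odd_mean_adj_combinations : preserves_combinations odd_mean_adj.
Proof.
intros a b x y n Ha Hb; unfold odd_mean_adj, scaled_tail, tail.
assert (Ha' := proj1 (ex_series_incr_n _ n) (ex_series_scaled a Ha)).
assert (Hb' := proj1 (ex_series_incr_n _ n) (ex_series_scaled b Hb)).
rewrite (Series_ext _ (fun k => x * (a (n + k)%nat / (INR (n + k) + 1) ^ 2)
                              + y * (b (n + k)%nat / (INR (n + k) + 1) ^ 2)))
  by (intros k; unfold Rdiv; ring).
rewrite Series_plus, !Series_scal_l; [ring | |].
- exact (ex_series_scal_l x _ Ha').
- exact (ex_series_scal_l y _ Hb').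
Qed.

Lemma sum_odd (n : nat) : sum_n (fun k => 2 * INR k + 1) n = (INR n + 1) ^ 2.
Proof.
induction n as [|n IH]; [rewrite sum_O; simpl; ring |].
rewrite sum_n_step, IH, S_INR; apply Rminus_diag_uniq; ring.
Qed.

(** Row [i] vanishes beyond the diagonal, so its partial sums are constant from index [i] on; before
    that they are initial values of [odd_sum] over [W i = (i + 1)^2]. *)
Lemma odd_mean_represents :
  represents (weighted_mean (fun n => 2 * INR n + 1))
             (complexify odd_mean odd_mean_sq_summable).
Proof.
intros f i.
set (b := fun j => Cmult (weighted_mean (fun n => 2 * INR n + 1) i j) (f j)).
assert (Hi : INR i + 1 <> 0) by (assert (H := pos_INR i); lra).
assert (Hlow : forall N, (N <= i)%nat -> sum_n b N =
  (odd_sum (re_seq f) (S N) / (INR i + 1) ^ 2, odd_sum (im_seq f) (S N) / (INR i + 1) ^ 2)).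
{ assert (Eb : forall j, (j <= i)%nat -> b j =
    ((2 * INR j + 1) * re_seq f j / (INR i + 1) ^ 2,
     (2 * INR j + 1) * im_seq f j / (INR i + 1) ^ 2)).
  { intros j Hj; unfold b, weighted_mean; rewrite sum_odd.
    rewrite (proj2 (Nat.leb_le j i) Hj).
    unfold Cmult, re_seq, im_seq, Re, Im; simpl; f_equal; field; exact Hi. }
  induction N as [|N IH]; intros HN.
  - rewrite sum_O, Eb by lia; simpl; f_equal; field; exact Hi.
  - rewrite sum_Sn, IH, Eb by lia.
    change plus with Cplus; cbv [Cplus fst snd].
    change (odd_sum (re_seq f) (S (S N))) with
      (odd_sum (re_seq f) (S N) + (2 * INR (S N) + 1) * re_seq f (S N)).
    change (odd_sum (im_seq f) (S (S N))) with
      (odd_sum (im_seq f) (S N) + (2 * INR (S N) + 1) * im_seq f (S N)).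
    f_equal; field; exact Hi. }
assert (Hhigh : forall k, sum_n b (i + k)%nat = complexify odd_mean odd_mean_sq_summable f i).
{ induction k as [|k IH]; [rewrite Nat.add_0_r; now apply Hlow |].
  rewrite Nat.add_succ_r, sum_Sn, IH.
  assert (Eb : b (S (i + k)) = zero).
  { unfold b, weighted_mean; rewrite (proj2 (Nat.leb_gt (S (i + k)) i)) by lia.
    apply Cmult_0_l. }
  rewrite Eb; apply plus_zero_r. }
apply (filterlim_ext_loc (fun _ => complexify odd_mean odd_mean_sq_summable f i)).
- exists i; intros n Hn; rewrite <- (Hhigh (n - i)%nat); f_equal; lia.
- apply filterlim_const.
Qed.

Theorem theorem2p3 :
  exists M : l2 -> l2,
    represents (weighted_mean (fun n => 2 * INR n + 1)) M /\ hyponormal M.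
Proof.
exists (complexify odd_mean odd_mean_sq_summable); split; [exact odd_mean_represents |].
(* The Hardy constant [5 / 2] is relaxed to a perfect square, giving the operator bound 2. *)
assert (Hbd : forall a, sq_summable a ->
  Series (fun n => odd_mean a n ^ 2) <= 2 ^ 2 * Series (fun n => a n ^ 2)).
{ intros a Ha; assert (H := odd_mean_norm_le a Ha).
  assert (H' := Series_ge_0 _ (fun n => pow2_ge_0 (a n)) Ha); lra. }
split.
{ apply (complexify_linear _ _ 2); [lra | exact odd_mean_combinations | exact Hbd]. }
exists (complexify odd_mean_adj odd_mean_adj_sq_summable).
assert (Hadj : forall f g, inner (complexify odd_mean odd_mean_sq_summable f) g
  = inner f (complexify odd_mean_adj odd_mean_adj_sq_summable g))
  by (intros f g; apply complexify_adjoint; exact odd_mean_adjoint).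
split; [split; [| exact Hadj] |].
- apply (complexify_linear _ _ 2); [lra | exact odd_mean_adj_combinations |].
  (* The adjoint inherits the bound 2 from the comparison of norms. *)
  intros a Ha; apply Rle_trans with (2 := Hbd a Ha); now apply odd_mean_adj_norm_le.
- intros f; set (A := complexify odd_mean _); set (B := complexify odd_mean_adj _).
  (* Moving [A] and [B] across turns the form into [||A f||^2 - ||B f||^2]; the conjugate symmetry
     is needed because [Hadj] only moves [A] out of the first argument. *)
  rewrite inner_minus_l, (inner_conj f (B (A f))).
  unfold A at 2; rewrite Hadj; fold B.
  unfold B at 1; rewrite <- Hadj; fold A.
  rewrite !inner_self; split; [| simpl; ring].
  change (0 <= l2_norm (A f) ^ 2 + - l2_norm (B f) ^ 2).
  rewrite !l2_norm_sqr_re_im.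
  assert (H1 := odd_mean_adj_norm_le _ (re_seq_sq_summable f)).
  assert (H2 := odd_mean_adj_norm_le _ (im_seq_sq_summable f)).
  change (re_seq (A f)) with (odd_mean (re_seq f)).
  change (im_seq (A f)) with (odd_mean (im_seq f)).
  change (re_seq (B f)) with (odd_mean_adj (re_seq f)).
  change (im_seq (B f)) with (odd_mean_adj (im_seq f)); lra.
Qed.
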